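(* Let $P$ and $\tilde P$ be Markov semigroups on measurable spaces $(V,\mathcal V)$ and $(\tilde V,\tilde{\mathcal V})$ with invariant probability measures $\nu$ and $\tilde\nu$ respectively. Assume that $P$ has an interweaving relation with $\tilde P$ with warm-up time $\tau$ and kernels $\Lambda,\tilde\Lambda$, with $\tilde\nu=\nu\Lambda$ and $\nu=\tilde\nu\tilde\Lambda$. Let $\varepsilon:\mathbb R_+\times\overline{\mathbb R}_+\to\overline{\mathbb R}_+$, where $\overline{\mathbb R}_+=\mathbb R_+\cup\{+\infty\}$, be non-decreasing in its second variable and such that $\lim_{t\to+\infty}\varepsilon(t,E)=0$ for all $E\in\mathbb R_+$. Assume that for every probability measure $\tilde m_0$ on $\tilde V$ and every $t\ge0$, $$\mathrm{Ent}(\tilde m_0\tilde P_t\,|\,\tilde\nu)\le\varepsilon\big(t,\mathrm{Ent}(\tilde m_0\,|\,\tilde\nu)\big).$$ Then for every probability measure $m_0$ on $V$ and every $t\ge0$, $$\mathrm{Ent}(m_0P_{t+\tau}\,|\,\nu)\le\varepsilon\big(t,\mathrm{Ent}(m_0\,|\,\nu)\big).$$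
   Context: A Markov semigroup on a measurable space $(V,\mathcal V)$ is a family $P=(P_t)_{t\ge0}$ of Markov (probability) kernels from $V$ to $V$ such that $(t,x)\mapsto P_t(x,A)$ is measurable for every $A\in\mathcal V$ and $P_tP_s=P_{t+s}$ for all $s,t\ge0$. A kernel acts on functions by $\Lambda f(x)=\int f(y)\Lambda(x,dy)$ and on probability measures by $m\Lambda(A)=\int m(dx)\Lambda(x,A)$. $P$ has an interweaving relation with $\tilde P$ with warm-up time $\tau$ (a non-negative random variable) and Markov kernels $\Lambda$ (from $V$ to $\tilde V$), $\tilde\Lambda$ (from $\tilde V$ to $V$) if for all $t\ge0$ $$P_t\Lambda=\Lambda\tilde P_t,\qquad \tilde P_t\tilde\Lambda=\tilde\Lambda P_t,\qquad \Lambda\tilde\Lambda=P_\tau:=\int_0^\infty P_s\,\mathbb P(\tau\in ds).$$ Moreover $P_{t+\tau}:=\int_0^\infty P_{t+s}\,\mathbb P(\tau\in ds)$. The relative entropy is $\mathrm{Ent}(m|\nu)=\int\ln\left(\frac{dm}{d\nu}\right)dm$ if $m\ll\nu$ and $+\infty$ otherwise. *)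

(* Defs.v *)
From HB Require Import structures.
From mathcomp Require Import all_boot all_order all_algebra.
From mathcomp Require Import all_classical all_reals all_analysis.
From mathcomp Require Import measurable_realfun giry.

Set Implicit Arguments.
Unset Strict Implicit.
Unset Printing Implicit Defensive.

Import Order.TTheory GRing.Theory Num.Theory.
Import numFieldNormedType.Exports.

Local Open Scope classical_set_scope.
Local Open Scope ring_scope.
Local Open Scope ereal_scope.

Section measure_kernel.
Context d d' (X : measurableType d) (Y : measurableType d') (R : realType).
Variables (m : probability X R) (k : R.-pker X ~> Y).

Definition mkact (A : set Y) : \bar R := \int[m]_x k x A.

Let mkact0 : mkact set0 = 0.
Proof. by apply: integral0_eq => x _; rewrite measure0. Qed.

Let mkact_ge0 A : 0 <= mkact A.
Proof. by apply: integral_ge0 => x _; exact: measure_ge0. Qed.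

Let mkact_sigma_additive : semi_sigma_additive mkact.
Proof.
move=> F mF tF mUF; rewrite /mkact.
rewrite [X in _ --> X](_ : _ = \sum_(n <oo) \int[m]_x k x (F n)); last first.
  rewrite -integral_nneseries//; last by move=> n; exact: measurable_kernel.
  apply: eq_integral => x _.
  by apply/esym/cvg_lim => //; exact: measure_semi_sigma_additive.
apply: is_cvg_nneseries => n _ _.
by apply: integral_ge0 => x _; exact: measure_ge0.
Qed.

HB.instance Definition _ := isMeasure.Build _ _ _ mkact
  mkact0 mkact_ge0 mkact_sigma_additive.

Let mkact_setT : mkact setT = 1.
Proof.
rewrite /mkact (eq_integral (cst 1)); last by move=> x _; exact: prob_kernel.
by rewrite integral_cst//= probability_setT mule1.
Qed.

HB.instance Definition _ := Measure_isProbability.Build _ _ _ mkact mkact_setT.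

Definition measure_kernel : probability Y R := mkact.

End measure_kernel.

(* Measures are total set functions whose values outside the sigma-algebra are
   irrelevant, so kernels are compared on measurable sets only (as measure_eq does
   for measures). *)
Definition eq_kernel d d' (X : measurableType d) (Y : measurableType d')
    (R : realType) (k1 k2 : X -> set Y -> \bar R) :=
  forall x A, measurable A -> k1 x A = k2 x A.

(* The time set is [0, +oo[; the kernels at negative times are junk. *)
Record markov_semigroup d (V : measurableType d) (R : realType) := {
  semigroup_kernel :> R -> R.-pker V ~> V ;
  semigroup_measurable : forall A, measurable A ->
    measurable_fun ([set t : R | (0 <= t)%R] `*` [set: V])
      (fun p : R * V => semigroup_kernel p.1 p.2 A) ;
  semigroupD : forall t s : R, (0 <= t)%R -> (0 <= s)%R ->
    eq_kernel (kcomp_noparam (semigroup_kernel t) (semigroup_kernel s))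
              (fun x => semigroup_kernel (t + s)%R x) }.

Definition invariant_measure d (V : measurableType d) (R : realType)
    (P : markov_semigroup V R) (nu : probability V R) :=
  forall t : R, (0 <= t)%R -> measure_eq (measure_kernel nu (P t)) nu.

Section random_time.
Context d d' (V : measurableType d) (O : measurableType d') (R : realType).
Variables (P : markov_semigroup V R) (Pr : probability O R) (tau : {RV Pr >-> R}).

(* P_tau *)
Definition warm_up (x : V) (A : set V) : \bar R :=
  \int[distribution Pr tau]_(s in [set s : R | (0 <= s)%R]) P s x A.

Variables (t : R).

(* P_{t + tau}; the sign conditions serve to make it a Markov kernel. *)
Definition delay of (forall w, (0 <= tau w)%R) & (0 <= t)%R :=
  fun (x : V) (A : set V) =>
  \int[distribution Pr tau]_(s in [set s : R | (0 <= s)%R]) P (t + s)%R x A.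

Hypotheses (tau0 : forall w, (0 <= tau w)%R) (t0 : (0 <= t)%R).

Let Rplus := [set s : R | (0 <= s)%R].

Let mRplus : measurable Rplus.
Proof. by rewrite /Rplus -set_itvcy; exact: measurable_itv. Qed.

Let measurable_shift A : measurable A ->
  measurable_fun ([set: V] `*` Rplus) (fun p : V * R => P (t + p.2)%R p.1 A).
Proof.
move=> mA.
apply: (@measurable_comp _ _ _ _ _ _ (Rplus `*` [set: V])
  (fun p : R * V => P p.1 p.2 A) _ (fun p : V * R => ((t + p.2)%R, p.1))).
- exact: measurableX.
- by move=> _ [[x s]] /= [_ s0] <-; split => //=; exact: addr_ge0.
- exact: semigroup_measurable.
- apply: measurable_funTS; apply/measurable_fun_pairP; split => /=.
  + by apply: measurable_funD => //; exact: measurable_snd.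
  + exact: measurable_fst.
Qed.

Let measurable_section x A : measurable A ->
  measurable_fun Rplus (fun s : R => P (t + s)%R x A).
Proof.
move=> mA.
apply: (@measurable_comp _ _ _ _ _ _ ([set: V] `*` Rplus)
  (fun p : V * R => P (t + p.2)%R p.1 A) _ (fun s : R => (x, s))).
- exact: measurableX.
- by move=> _ [s s0 <-]; split.
- exact: measurable_shift.
- by apply: measurable_funTS; exact: pair1_measurable.
Qed.

Let delay0 x : delay tau0 t0 x set0 = 0.
Proof. by apply: integral0_eq => s _; rewrite measure0. Qed.

Let delay_ge0 x A : 0 <= delay tau0 t0 x A.
Proof. by apply: integral_ge0 => s _; exact: measure_ge0. Qed.

Let delay_sigma_additive x : semi_sigma_additive (delay tau0 t0 x).
Proof.
move=> F mF tF mUF; rewrite /delay.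
rewrite [X in _ --> X](_ : _ = \sum_(n <oo)
    \int[distribution Pr tau]_(s in Rplus) P (t + s)%R x (F n)); last first.
  rewrite -integral_nneseries//; last by move=> n; exact: measurable_section.
  apply: eq_integral => s _.
  by apply/esym/cvg_lim => //; exact: measure_semi_sigma_additive.
apply: is_cvg_nneseries => n _ _.
by apply: integral_ge0 => s _; exact: measure_ge0.
Qed.

HB.instance Definition _ x := isMeasure.Build _ _ _ (delay tau0 t0 x)
  (delay0 x) (delay_ge0 x) (@delay_sigma_additive x).

Definition mdelay : V -> {measure set V -> \bar R} := delay tau0 t0.

Let measurable_mdelay U : measurable U -> measurable_fun [set: V] (mdelay ^~ U).
Proof.
move=> mU; pose f := (fun p : V * R => P (t + p.2)%R p.1 U) \_ ([set: V] `*` Rplus).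
rewrite (_ : mdelay ^~ U =
    (fun x => \int[distribution Pr tau]_s f (x, s))); last first.
  apply/funext => x; rewrite /mdelay/= /delay integral_mkcond.
  apply: eq_integral => s _.
  by rewrite /f /patch in_setX in_setT.
apply: (@measurable_fun_integral_finite_kernel _ _ _ _ _ f
  (kprobability (measurable_cst (distribution Pr tau : pprobability R R)))).
- by move=> z; rewrite /f /patch; case: ifP.
- apply/(measurable_restrictT _ _).1; first exact: measurableX.
  exact: measurable_shift.
Qed.

HB.instance Definition _ := isKernel.Build _ _ _ _ _ mdelay measurable_mdelay.

Let mdelay_setT x : mdelay x [set: V] = 1.
Proof.
rewrite /mdelay /= /delay (eq_integral (cst 1)); last first.
  by move=> s _; exact: prob_kernel.
rewrite integral_cst//= mul1e /distribution /pushforward.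
rewrite (_ : _ @^-1` _ = setT) ?probability_setT//.
by apply/seteqP; split => // w _; exact: tau0.
Qed.

HB.instance Definition _ :=
  Kernel_isProbability.Build _ _ _ _ _ mdelay mdelay_setT.

Definition delayed_kernel : R.-pker V ~> V := mdelay.

End random_time.

Section interweaving.
Context d d' d'' (V : measurableType d) (V' : measurableType d')
  (O : measurableType d'') (R : realType).
Variables (P : markov_semigroup V R) (P' : markov_semigroup V' R).
Variables (Pr : probability O R) (tau : {RV Pr >-> R}).
Variables (L : R.-pker V ~> V') (L' : R.-pker V' ~> V).

Record interweaving : Prop := {
  interweaving_intertwine : forall t : R, (0 <= t)%R ->
    eq_kernel (kcomp_noparam (P t) L) (kcomp_noparam L (P' t)) ;
  interweaving_intertwine' : forall t : R, (0 <= t)%R ->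
    eq_kernel (kcomp_noparam (P' t) L') (kcomp_noparam L' (P t)) ;
  interweaving_warm_up : eq_kernel (kcomp_noparam L L') (warm_up P tau) }.

End interweaving.

(* lne is the logarithm on \bar R with lne 0 = -oo; the points where the density
   is not positive form an m-null set. *)
Definition Ent d (V : measurableType d) (R : realType)
    (m nu : probability V R) : \bar R :=
  if `[< m `<< nu >]
  then \int[m]_x lne (Radon_Nikodym (charge_of_finite_measure m) nu x)
  else +oo.

(* Main.v *)
Require Import Defs.
From HB Require Import structures.
From mathcomp Require Import all_boot all_order all_algebra.
From mathcomp Require Import all_classical all_reals all_analysis.
From mathcomp Require Import measurable_realfun giry.
From mathcomp Require Import lra.

Import Order.TTheory GRing.Theory Num.Theory.
Import numFieldNormedType.Exports.

Local Open Scope classical_set_scope.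
Local Open Scope ring_scope.
Local Open Scope ereal_scope.

(* Each of Lambda, Lambda~ can only decrease the relative entropy, and
   m P_{t+tau} = m P_t Lambda Lambda~ = m Lambda P~_t Lambda~, so that
     Ent(m P_{t+tau} | nu) <= Ent(m Lambda P~_t | nu~)
       <= eps(t, Ent(m Lambda | nu~)) <= eps(t, Ent(m | nu)).
   The monotonicity of the entropy under a Markov kernel K needs neither Jensen
   nor disintegration: if f = dm/dnu and g = d(mK)/d(nuK), integrate
     ln g(y) - ln f(x) <= g(y) / f(x) - 1
   against m(dx) K(x,dy); the right-hand side contributes at most
     int f(x)/f(x) Kg(x) nu(dx) - 1 <= int g d(nuK) - 1 = 0. *)

Lemma integral_measure_kernel (R : realType) (d d' : measure_display)
    (X : measurableType d) (Y : measurableType d') (m : probability X R)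
    (k : R.-pker X ~> Y) (h : Y -> \bar R) :
  (forall y, 0 <= h y) -> measurable_fun [set: Y] h ->
  \int[measure_kernel m k]_y h y = \int[m]_x \int[k x]_y h y.
Proof.
move=> h0 mh.
(* The law [m] is viewed as a constant kernel out of [unit], which turns [measure_kernel m k] into a
   composition of kernels. *)
exact: (@integral_kcomp _ _ _ unit X Y R
  (kprobability (measurable_cst (m : pprobability X R)))
  (kernel.kernel_snd k) tt h h0 mh).
Qed.

Lemma measurable_lne_EFin (R : realType) :
  measurable_fun [set: R] (fun r : R => lne r%:E).
Proof.
rewrite /lne; apply: measurable_fun_ifT => //.
- exact: measurable_fun_ler.
- exact: measurableT_comp.
Qed.

(* ln s - ln r <= s / r - 1, rearranged so that both sides are sums of
   nonnegative terms, which may be integrated without integrability hypotheses *)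
Lemma lne_tangent (R : realType) (r s : R) : (0 < r)%R -> (0 <= s)%R ->
  1 + (maxe (lne s%:E) 0 + maxe (- lne r%:E) 0)
    <= maxe (lne r%:E) 0 + (maxe (- lne s%:E) 0 + (r^-1 * s)%:E).
Proof.
move=> r0; rewrite le_eqVlt => /predU1P[<-|s0].
  (* For s = 0 the negative part of [lne s%:E] is [+oo], so the right-hand side is infinite. *)
  rewrite (@le0_lneNy _ 0%:E)// lne_EFin// (_ : maxe (- -oo) 0 = +oo)//.
  by rewrite addye// -EFin_max addey ?leey// -EFin_max.
rewrite !lne_EFin// -!EFinN -!EFin_max -!EFinD lee_fin.
have : (ln s - ln r <= r^-1 * s - 1)%R.
  rewrite -ln_div ?posrE// (mulrC _ s).
  have sr0 : (0 < s / r)%R by rewrite divr_gt0.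
  by have := @le_ln1Dx _ (s / r - 1)%R; rewrite [(1 + _)%R]addrC subrK; apply; lra.
by case: (leP (ln s) 0%R); case: (leP (- ln r)%R 0%R); case: (leP (ln r) 0%R);
  case: (leP (- ln s)%R 0%R); lra.
Qed.

(** [Ent] integrates the derivative of [m] seen as a charge, while the change of variables concerns
    the derivative of sigma-finite measures. The two agree nu-almost everywhere, hence m-almost
    everywhere by absolute continuity, so one finite nonnegative version serves both purposes. *)
Lemma Ent_density {R : realType} {d : measure_display} {V : measurableType d}
    {m nu : probability V R} : m `<< nu ->
  exists f : V -> R, [/\ measurable_fun [set: V] f,
    forall x, (0 <= f x)%R,
    forall h : V -> \bar R, (forall x, 0 <= h x) ->
      measurable_fun [set: V] h ->
      \int[nu]_x (h x * (f x)%:E) = \int[m]_x h x &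
    Ent m nu = \int[m]_x lne (f x)%:E].
Proof.
move=> mnu; pose F := Radon_Nikodym_SigmaFinite.f m nu.
have FE x : (fine (F x))%:E = F x.
  by rewrite fineK// Radon_Nikodym_SigmaFinite.f_fin_num.
have mF : measurable_fun [set: V] F.
  exact: measurable_int (Radon_Nikodym_SigmaFinite.f_integrable _).
exists (fine \o F); split.
- exact: measurableT_comp.
- by move=> x; apply: fine_ge0; exact: Radon_Nikodym_SigmaFinite.f_ge0.
- move=> h h0 mh; rewrite -(Radon_Nikodym_SigmaFinite.change_of_variables mnu)//.
  by apply: eq_integral => x _; rewrite FE.
- rewrite /Ent asboolT//; apply: ae_eq_integral => //.
  + rewrite (_ : (fun x => _) = (fun r : R => lne r%:E) \o
        (fine \o Radon_Nikodym (charge_of_finite_measure m) nu)); last first.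
      by apply/funext => x; congr lne; rewrite fineK// Radon_Nikodym_fin_num.
    apply: measurableT_comp; first exact: measurable_lne_EFin.
    exact: measurableT_comp.
  + apply: (measurableT_comp (measurable_lne_EFin R)).
    exact: measurableT_comp.
  + have := null_dominates_ae_eq measurableT mnu
      (ae_eq_Radon_Nikodym_SigmaFinite mnu measurableT).
    by apply: filterS => x + xV => /(_ xV) FR; congr lne; rewrite -FR; exact/esym/FE.
Qed.

(** Here [f] stands for dm/dnu, but [g] may be any nonnegative function of mass 1 under nu k. This
    covers both the density of m k and the constant 1, which yields the nonnegativity of the
    entropy. *)
Lemma integral_lne_le {R : realType} {d d' : measure_display}
    {V : measurableType d} {W : measurableType d'} {m nu : probability V R}
    {k : R.-pker V ~> W} {f : V -> R} {g : W -> R} :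
  measurable_fun [set: V] f -> (forall x, (0 <= f x)%R) ->
  (forall h : V -> \bar R, (forall x, 0 <= h x) -> measurable_fun [set: V] h ->
    \int[nu]_x (h x * (f x)%:E) = \int[m]_x h x) ->
  measurable_fun [set: W] g -> (forall y, (0 <= g y)%R) ->
  \int[measure_kernel nu k]_y (g y)%:E = 1 ->
  \int[measure_kernel m k]_y lne (g y)%:E <= \int[m]_x lne (f x)%:E.
Proof.
move=> mf f0 nuf mg g0 intg.
have mf0 : measurable [set x | f x = 0%R].
  by rewrite -[X in measurable X]setTI; apply: (mf measurableT [set 0%R]).
have mEf : measurable_fun [set: V] (EFin \o f) by exact/measurable_EFinP.
have mEg : measurable_fun [set: W] (EFin \o g) by exact/measurable_EFinP.
have mVf : measurable_fun [set: V] (fun x => (f x)^-1%:E).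
  apply/measurable_EFinP.
  rewrite (_ : (fun x => _) = (fun x => powR (f x) (-1))); last first.
    by apply/funext => x; rewrite powR_inv1.
  exact: (measurableT_comp (measurable_powR (-1))).
pose a x := lne (f x)%:E; pose b y := lne (g y)%:E.
have ma : measurable_fun [set: V] a.
  exact: (measurableT_comp (measurable_lne_EFin R)).
have mb : measurable_fun [set: W] b.
  exact: (measurableT_comp (measurable_lne_EFin R)).
have map := measurable_funepos ma; have man := measurable_funeneg ma.
have mbp := measurable_funepos mb; have mbn := measurable_funeneg mb.
(* m(f = 0) is the nu-integral of f over {f = 0}, which vanishes. *)
have f_gt0 : {ae m, forall x, (0 < f x)%R}.
  exists [set x | f x = 0%R]; split.
  - exact: mf0.
  - have <- : \int[nu]_x ((\1_[set x | f x = 0%R] x)%:E * (f x)%:E) = 0.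
      apply: integral0_eq => x _; rewrite indicE -EFinM.
      have [fx0|fx0] := eqVneq (f x) 0%R; first by rewrite fx0 mulr0.
      by rewrite memNset ?mul0r//=; exact/eqP.
    rewrite nuf//.
    + by rewrite integral_indic ?setIT.
    + exact/measurable_EFinP.
  - by move=> x /= /negP; rewrite -leNgt => fx0; apply/eqP; rewrite eq_le fx0 f0.
(* Only an inequality: as [0^-1 = 0], the product of f and its inverse is 1 where f > 0 and 0
   elsewhere. *)
have Vf_le h : (forall x, 0 <= h x) -> measurable_fun [set: V] h ->
    \int[m]_x ((f x)^-1%:E * h x) <= \int[nu]_x h x.
  move=> h0 mh; rewrite -nuf; last 2 first.
  - by move=> x; rewrite mule_ge0// lee_fin invr_ge0.
  - exact: emeasurable_funM.
  apply: ge0_le_integral => //.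
  - by move=> x _; rewrite !mule_ge0// lee_fin ?invr_ge0.
  - by apply: emeasurable_funM => //; exact: emeasurable_funM.
  - move=> x _; rewrite muleAC -EFinM; have [->|fx0] := eqVneq (f x) 0%R.
      by rewrite mulr0 mul0e.
    by rewrite mulVf// mul1e.
(* Where f > 0, the negative part of ln f is at most 1/f, whose m-integral is at most nu(V) = 1.
   Hence the integral of ln f against m is never of the form oo - oo. *)
have an_fin : \int[m]_x a^\- x < +oo.
  apply: (@le_lt_trans _ _ 1); last exact: ltry.
  apply: (@le_trans _ _ (\int[m]_x ((f x)^-1%:E * 1))); last first.
    apply: (le_trans (Vf_le (cst 1) _ _)) => //.
    by rewrite integral_cst//= probability_setT mule1.
  apply: ae_ge0_le_integral => //.
  - by move=> x _; rewrite mule1 lee_fin invr_ge0.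
  - by apply: emeasurable_funM.
  - apply: filterS f_gt0 => x fx0 _.
    rewrite mule1 funenegE /a lne_EFin// -EFinN -EFin_max lee_fin -lnV ?posrE//.
    by rewrite ge_max invr_ge0 f0 andbT ltW// ln_sublinear// invr_gt0.
(* The tangent inequality integrated against m(dx) k(x,dy), in subtraction-free form; the last 1
   bounds the integral of g(y)/f(x). *)
have key : 1 + (\int[measure_kernel m k]_y b^\+ y + \int[m]_x a^\- x) <=
    \int[m]_x a^\+ x + (\int[measure_kernel m k]_y b^\- y + 1).
  pose G x := \int[k x]_y (g y)%:E; pose Bp x := \int[k x]_y b^\+ y.
  pose Bn x := \int[k x]_y b^\- y.
  have mk h : (forall y, 0 <= h y) -> measurable_fun [set: W] h ->
      measurable_fun [set: V] (fun x => \int[k x]_y h y).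
    by apply: measurable_fun_integral_kernel => U mU; exact: measurable_kernel.
  have mG : measurable_fun [set: V] G by apply: mk.
  have mBp : measurable_fun [set: V] Bp by apply: mk.
  have mBn : measurable_fun [set: V] Bn by apply: mk.
  have G0 x : 0 <= G x by apply: integral_ge0 => y _; rewrite lee_fin.
  have Bp0 x : 0 <= Bp x by exact: integral_ge0.
  have Bn0 x : 0 <= Bn x by exact: integral_ge0.
  have VG0 x : 0 <= (f x)^-1%:E * G x by rewrite mule_ge0// lee_fin invr_ge0.
  have mVG : measurable_fun [set: V] (fun x => (f x)^-1%:E * G x).
    exact: emeasurable_funM.
  have le_VG : \int[m]_x ((f x)^-1%:E * G x) <= 1.
    by rewrite (le_trans (Vf_le _ G0 mG))// -integral_measure_kernel// intg.
  apply: (@le_trans _ _ (\int[m]_x a^\+ x +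
      (\int[measure_kernel m k]_y b^\- y +
       \int[m]_x ((f x)^-1%:E * G x)))); last first.
    by rewrite leeD2l// leeD2l.
  rewrite !integral_measure_kernel//.
  rewrite -(ge0_integralD m)//.
  rewrite -(ge0_integralD m)//.
  rewrite -(ge0_integralD m)//.
  have -> : 1 = \int[m]_x cst 1 x.
    by rewrite integral_cst//= probability_setT mule1.
  rewrite -(ge0_integralD m)//.
  apply: ae_ge0_le_integral => //.
  - by move=> x _; apply: adde_ge0 => //; apply: adde_ge0 => //; exact: Bp0.
  - by apply: emeasurable_funD => //; apply: emeasurable_funD.
  - by move=> x _; apply: adde_ge0 => //; apply: adde_ge0 => //; exact: Bn0.
  - by apply: emeasurable_funD => //; apply: emeasurable_funD.
  apply: filterS f_gt0 => x fx0 _.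
  (* Each [k x] has mass 1, so terms depending on x alone become integrals in y, and [lne_tangent]
     applies pointwise under a single integral. *)
  have kcst c : c = \int[k x]_y (cst c y).
    by rewrite integral_cst//= prob_kernel mule1.
  rewrite [cst 1 x](kcst 1) (kcst (a^\- x)) (kcst (a^\+ x)).
  rewrite /G -ge0_integralZl_EFin//; last by rewrite invr_ge0.
  have m1 : measurable_fun [set: W] (fun y => (f x)^-1%:E * (g y)%:E).
    exact: emeasurable_funM.
  have p1 y : 0 <= (f x)^-1%:E * (g y)%:E.
    by rewrite -EFinM lee_fin mulr_ge0 ?invr_ge0.
  rewrite -!ge0_integralD//=.
  - apply: ge0_le_integral => //.
    + by move=> y _; rewrite !adde_ge0.
    + by do 2 apply: emeasurable_funD => //.
    + by do 2 apply: emeasurable_funD => //.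
    + move=> y _; rewrite !funeposE !funenegE -EFinM.
      exact: lne_tangent.
  - by move=> y _; apply: adde_ge0.
  - exact: emeasurable_funD.
  - by move=> y _; apply: adde_ge0.
  - exact: emeasurable_funD.
  - by move=> y _; rewrite lee_fin.
  - by move=> x _; apply: adde_ge0 => //; exact: Bp0.
  - exact: emeasurable_funD.
  - by move=> x _; apply: adde_ge0 => //; exact: Bn0.
  - exact: emeasurable_funD.
  - by move=> x _; exact: Bn0.
  - by move=> x _; exact: Bp0.
rewrite [leLHS](integralE _ _ b) [leRHS](integralE _ _ a).
(* If the negative part of ln g has infinite integral, the left-hand side is [-oo], because [-oo]
   absorbs every summand. *)
have [bn_fin|] := ltP (\int[measure_kernel m k]_y b^\- y) +oo; last first.
  by rewrite leye_eq => /eqP ->; rewrite addeNy leNye.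
have fin_EFin (z : \bar R) : 0 <= z -> z < +oo -> exists r : R, z = r%:E.
  by move=> z0 zoo; exists (fine z); rewrite fineK// ge0_fin_numE.
have [an anE] := fin_EFin _ (@integral_ge0 _ _ _ _ _ _ (fun x _ => funeneg_ge0 a x)) an_fin.
have [bn bnE] := fin_EFin _ (@integral_ge0 _ _ _ _ _ _ (fun x _ => funeneg_ge0 b x)) bn_fin.
move: key; rewrite anE bnE.
(* Both negative parts are now finite; [key] excludes an infinite positive part on the left unless
   the one on the right is infinite too. *)
case: (\int[measure_kernel m k]_y b^\+ y) => [bp||];
  case: (\int[m]_x a^\+ x) => [ap||] //=; rewrite ?addye ?addNye ?leNye ?leey//.
by rewrite -!EFinD !lee_fin; lra.
Qed.

(** Data processing inequality. Taking [m'] and [nu'] up to equality on measurable sets lets it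
    apply directly to [nu] as a representative of the image of [nu'] under [L']. *)
Lemma Ent_le_kernel (R : realType) (d d' : measure_display)
    (V : measurableType d) (W : measurableType d') (m nu : probability V R)
    (m' nu' : probability W R) (k : R.-pker V ~> W) :
  measure_eq m' (measure_kernel m k) -> measure_eq nu' (measure_kernel nu k) ->
  Ent m' nu' <= Ent m nu.
Proof.
move=> m'E nu'E; have [mnu|/asboolPn mnu] := asboolP (m `<< nu); last first.
  by rewrite {2}/Ent (negbTE mnu) leey.
(* If nu k (A) = 0, the nonnegative function k(., A) vanishes nu-almost everywhere, hence m-almost
   everywhere, so m k (A) = 0. *)
have m'nu' : m' `<< nu'.
  apply/null_content_dominatesP => A mA.
  move=> /(etrans (esym (nu'E A mA))) nukA0.
  transitivity (measure_kernel m k A); first exact: m'E.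
  have mkA := measurable_kernel k A mA.
  have kA0 : ae_eq nu setT (k ^~ A) (cst 0).
    apply/(ae_eq_integral_abs nu measurableT mkA).
    by rewrite -[RHS]nukA0; apply: eq_integral => x _; rewrite gee0_abs.
  rewrite [LHS](ae_eq_integral (cst 0))//; first exact: integral0.
  exact: null_dominates_ae_eq kA0.
have [f [mf f0 nuf ->]] := Ent_density mnu.
have [g [mg g0 nug ->]] := Ent_density m'nu'.
rewrite (eq_measure_integral (measure_kernel m k)); last by move=> *; exact: m'E.
apply: integral_lne_le nuf _ _ _ => //.
transitivity (\int[nu']_y (g y)%:E).
  by apply: eq_measure_integral => A mA _; exact/esym/nu'E.
under eq_integral do rewrite -[_%:E]mul1e.
by rewrite (nug (cst 1))// integral_cst//= probability_setT mule1.
Qed.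

(** The case g = 1 of [integral_lne_le], with the constant kernel [nu]: the left-hand side there is
    the integral of ln 1 = 0. It serves to apply the monotonicity of [eps], assumed for nonnegative
    arguments. *)
Lemma Ent_ge0 (R : realType) (d : measure_display) (V : measurableType d)
    (m nu : probability V R) : 0 <= Ent m nu.
Proof.
have [mnu|/asboolPn mnu] := asboolP (m `<< nu); last first.
  by rewrite /Ent (negbTE mnu) leey.
have [f [mf f0 nuf ->]] := Ent_density mnu.
pose k : R.-pker V ~> V := kprobability (measurable_cst (nu : pprobability V R)).
apply: le_trans (integral_lne_le (k := k) (g := cst 1%R) mf f0 nuf _ _ _) => //.
  by rewrite integral0_eq// => y _; rewrite lne1.
by rewrite (integral_cst _ _ 1%E)//= probability_setT mule1.
Qed.

(** A semigroup is measurable in time only on [0, +oo[, so joint measurability is asked on X x D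
    alone; extending F by 0 off D reduces the claim to Tonelli on the whole product. *)
Lemma fubini_tonelli_setT_within (R : realType) (d d' : measure_display)
    (X : measurableType d) (Y : measurableType d') (m : probability X R)
    (p : probability Y R) (D : set Y) (F : X -> Y -> \bar R) :
  measurable D -> (forall x y, 0 <= F x y) ->
  measurable_fun ([set: X] `*` D) (fun z => F z.1 z.2) ->
  \int[m]_x \int[p]_(y in D) F x y = \int[p]_(y in D) \int[m]_x F x y.
Proof.
move=> mD F0 mF; pose f := (fun z : X * Y => F z.1 z.2) \_ ([set: X] `*` D).
have f0 z : 0 <= f z by rewrite /f /patch; case: ifP.
have mf : measurable_fun [set: X * Y] f.
  by apply/(measurable_restrictT _ _).1 => //; exact: measurableX.
have fE x y : f (x, y) = if y \in D then F x y else 0.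
  by rewrite /f /patch in_setX in_setT.
transitivity (\int[m]_x \int[p]_y f (x, y)).
  apply: eq_integral => x _; rewrite integral_mkcond.
  by apply: eq_integral => y _; rewrite fE.
rewrite fubini_tonelli// [RHS]integral_mkcond; apply: eq_integral => y _.
rewrite patchE; case: ifPn => yD.
  by apply: eq_integral => x _; rewrite fE yD.
by apply: integral0_eq => x _; rewrite fE (negbTE yD).
Qed.

Lemma measurable_semigroup_shift (R : realType) (d : measure_display)
    (V : measurableType d) (P : markov_semigroup V R) (t : R) (A : set V) :
  (0 <= t)%R -> measurable A ->
  measurable_fun ([set: V] `*` [set s : R | (0 <= s)%R])
    (fun z => P (t + z.2)%R z.1 A).
Proof.
move=> t0 mA.
apply: (@measurable_comp _ _ _ _ _ _ ([set s : R | (0 <= s)%R] `*` [set: V])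
  (fun p : R * V => P p.1 p.2 A) _ (fun p : V * R => ((t + p.2)%R, p.1))).
- apply: measurableX => //; rewrite -set_itvcy; exact: measurable_itv.
- by move=> _ [[x s]] /= [_ s0] <-; split => //=; exact: addr_ge0.
- exact: semigroup_measurable.
- apply: measurable_funTS; apply/measurable_fun_pairP; split => /=.
  + by apply: measurable_funD => //; exact: measurable_snd.
  + exact: measurable_fst.
Qed.

Lemma measure_kernel_comp (R : realType) (d1 d2 d3 : measure_display)
    (X : measurableType d1) (Y : measurableType d2) (Z : measurableType d3)
    (m : probability X R) (k1 : R.-pker X ~> Y) (k2 : R.-pker Y ~> Z)
    (A : set Z) : measurable A ->
  measure_kernel (measure_kernel m k1) k2 A =
    \int[m]_x kcomp_noparam k1 k2 x A.
Proof.
by move=> mA; apply: integral_measure_kernel => //; exact: measurable_kernel.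
Qed.

(** Tonelli makes the time integral outermost both in m P_{t+tau} and in (m P_t) P_tau; for each
    fixed s >= 0 what remains is P_{t+s} = P_t P_s. *)
Lemma measure_kernel_delay (R : realType) (d d' : measure_display)
    (V : measurableType d) (O : measurableType d') (P : markov_semigroup V R)
    (Pr : probability O R) (tau : {RV Pr >-> R})
    (tau0 : forall w, (0 <= tau w)%R) (t : R) (t0 : (0 <= t)%R)
    (m : probability V R) (A : set V) : measurable A ->
  measure_kernel m (delayed_kernel P tau0 t0) A =
    \int[measure_kernel m (P t)]_y warm_up P tau y A.
Proof.
move=> mA; pose D := [set s : R | (0 <= s)%R].
have mD : measurable D by rewrite /D -set_itvcy; exact: measurable_itv.
rewrite [RHS](@fubini_tonelli_setT_within R _ _ V _ _ (distribution Pr tau) D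
  (fun y s => P s y A))//; last first.
  (* The shift by t = 0 gives the joint measurability of (y, s) -> P_s(y, A). *)
  apply: eq_measurable_fun (measurable_semigroup_shift _ _ _ P 0%R A _ mA) => //.
  by move=> z _; rewrite add0r.
rewrite [LHS](@fubini_tonelli_setT_within R _ _ V _ _ (distribution Pr tau) D
  (fun y s => P (t + s)%R y A))//; last exact: measurable_semigroup_shift.
apply: eq_integral => s /set_mem s0.
rewrite integral_measure_kernel//; last exact: measurable_kernel.
by apply: eq_integral => x _; rewrite -semigroupD.
Qed.

Theorem theorem8 (R : realType) (d d' d'' : measure_display)
  (V : measurableType d) (V' : measurableType d')
  (P : markov_semigroup V R) (P' : markov_semigroup V' R)
  (nu : probability V R) (nu' : probability V' R)
  (nu_inv : invariant_measure P nu) (nu'_inv : invariant_measure P' nu')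
  (O : measurableType d'') (Pr : probability O R) (tau : {RV Pr >-> R})
  (tau_ge0 : forall w : O, (0 <= tau w)%R)
  (L : R.-pker V ~> V') (L' : R.-pker V' ~> V)
  (PP' : interweaving P P' tau L L')
  (nuL : measure_eq nu' (measure_kernel nu L))
  (nu'L' : measure_eq nu (measure_kernel nu' L'))
  (eps : R -> \bar R -> \bar R)
  (eps_ge0 : forall (t : R) (E : \bar R), (0 <= t)%R -> 0 <= E -> 0 <= eps t E)
  (eps_nd : forall (t : R) (E1 E2 : \bar R), (0 <= t)%R -> 0 <= E1 ->
    E1 <= E2 -> eps t E1 <= eps t E2)
  (eps_cvg0 : forall E : R, (0 <= E)%R -> eps t E%:E @[t --> +oo%R] --> 0)
  (Ent_decay : forall (m : probability V' R) (t : R), (0 <= t)%R ->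
    Ent (measure_kernel m (P' t)) nu' <= eps t (Ent m nu')) :
  forall (m : probability V R) (t : R) (t_ge0 : (0 <= t)%R),
    Ent (measure_kernel m (delayed_kernel P tau_ge0 t_ge0)) nu
      <= eps t (Ent m nu).
Proof.
move=> m t t0.
have mL_le : Ent (measure_kernel m L) nu' <= Ent m nu.
  exact: Ent_le_kernel nuL.
apply: le_trans (eps_nd _ _ _ t0 (Ent_ge0 _ _ _ _ _) mL_le).
apply: le_trans (Ent_decay _ _ t0).
apply: Ent_le_kernel nu'L' => A mA.
rewrite [LHS]measure_kernel_delay//.
(* The left-hand side is now (m P_t) P_tau. The warm-up identity expands P_tau into [L] followed by
   [L']; the intertwining then replaces P_t L by L P'_t. *)
transitivity (measure_kernel (measure_kernel (measure_kernel m (P t)) L) L' A).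
  rewrite [RHS]measure_kernel_comp//; apply: eq_integral => y _.
  by rewrite (interweaving_warm_up PP').
apply: eq_measure_integral => B mB _;
rewrite [LHS]measure_kernel_comp// [RHS]measure_kernel_comp//.
by apply: eq_integral => x _; rewrite (interweaving_intertwine PP').
Qed.
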